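(* Let $Y,H,Y^\star,H^\star$ be random variables with finite moments, with means $\mu=(\mu_Y,\mu_H,\mu_{Y^\star},\mu_{H^\star})$ and standard deviations $(\sigma_Y,\sigma_H,\sigma_{Y^\star},\sigma_{H^\star})$, and let $g$ be a real-valued differentiable function. For $\theta\in\mathbb{R}$ let $$T_0=g(Y)-g(Y^\star),\quad T_1=g(Y)-\theta g(H),\quad T_2=g(Y^\star)-\theta g(H^\star),\quad T=T_1-T_2=g(Y)-\theta g(H)-\big(g(Y^\star)-\theta g(H^\star)\big).$$ Assume all pairwise correlations among $Y,H,Y^\star,H^\star$ are zero except for those of $(Y,H)$ and $(Y^\star,H^\star)$, and let $\rho=\mathrm{cor}(Y,H)$, $\rho^\star=\mathrm{cor}(Y^\star,H^\star)$. Let $V$ denote the first-order (delta-method) approximation of the variance. Then: (a) The value of $\theta$ minimizing $V\{T\}$ is $$\theta_{opt}=\frac{g'(\mu_H)g'(\mu_Y)\,\mathrm{cov}(Y,H)+g'(\mu_{H^\star})g'(\mu_{Y^\star})\,\mathrm{cov}(Y^\star,H^\star)}{g'(\mu_H)^2\sigma_H^2+g'(\mu_{H^\star})^2\sigma_{H^\star}^2}.$$ For $g$ the identity, $\theta_{opt}=\dfrac{\mathrm{cov}(Y,H)+\mathrm{cov}(Y^\star,H^\star)}{\sigma_H^2+\sigma_{H^\star}^2}$. For $g=\log$, $$\theta_{opt}=\frac{\mathrm{cov}(Y,H)/(\mu_H\mu_Y)+\mathrm{cov}(Y^\star,H^\star)/(\mu_{H^\star}\mu_{Y^\star})}{\sigma_H^2/\mu_H^2+\sigma_{H^\star}^2/\mu_{H^\star}^2}.$$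 (b) The minimum of $V\{T\}$ over $\theta$ equals $g'(\mu_Y)^2\sigma_Y^2+g'(\mu_{Y^\star})^2\sigma_{Y^\star}^2-\delta$, where $$\delta=\frac{\big(g'(\mu_H)g'(\mu_Y)\,\mathrm{cov}(Y,H)+g'(\mu_{H^\star})g'(\mu_{Y^\star})\,\mathrm{cov}(Y^\star,H^\star)\big)^2}{g'(\mu_H)^2\sigma_H^2+g'(\mu_{H^\star})^2\sigma_{H^\star}^2};$$ hence $V\{T_0\}-V\{T\}=\delta$ at $\theta=\theta_{opt}$. For $g$ the identity, $\delta=\dfrac{(\mathrm{cov}(Y,H)+\mathrm{cov}(Y^\star,H^\star))^2}{\sigma_H^2+\sigma_{H^\star}^2}$. For $g=\log$, $$\delta=\frac{\big(\mathrm{cov}(Y,H)/(\mu_H\mu_Y)+\mathrm{cov}(Y^\star,H^\star)/(\mu_{H^\star}\mu_{Y^\star})\big)^2}{\sigma_H^2/\mu_H^2+\sigma_{H^\star}^2/\mu_{H^\star}^2}.$$ (c) $\min\{\theta_1,\theta_2\}\le\theta_{opt}\le\max\{\theta_1,\theta_2\}$, where $\theta_i$ is the value of $\theta$ minimizing $V\{T_i\}$, $i=1,2$. (d) If moreover $g'(\mu_H)\sigma_H=g'(\mu_{H^\star})\sigma_{H^\star}$ and $\rho\,g'(\mu_Y)\sigma_Y=\rho^\star g'(\mu_{Y^\star})\sigma_{Y^\star}$, then at $\theta=\theta_{opt}$ $$V\{T\}=(1-\rho^2)\,V\{g(Y)\}+(1-(\rho^\star)^2)\,V\{g(Y^\s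tar)\}\le\big(1-\min\{\rho^2,(\rho^\star)^2\}\big)\,V\{T_0\}.$$
   Context: First-order (delta-method) variance: for a random vector $U$ with mean $\mu$ and finite second moments and a real function $F$ differentiable at $\mu$, $V\{F(U)\}:=\mathrm{Var}\big(\nabla F(\mu)\cdot(U-\mu)\big)$, i.e. the variance of the first-order Taylor expansion of $F(U)$ around $\mu$. The statistics in the claim are regarded as functions of $U=(Y,H,Y^\star,H^\star)$ (with $\theta$ a fixed parameter). Conventions: the function $g$ is defined on a set containing the values and the means of the four variables and differentiable at the means (for $g=\log$ the variables are positive); all standard deviations are positive, and $g'(\mu_H)\ne0$, $g'(\mu_{H^\star})\ne0$. *)

(* Defs.v *)
From HB Require Import structures.
From mathcomp Require Import all_boot all_order all_algebra.
From mathcomp Require Import all_classical all_reals all_analysis.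
Set Implicit Arguments.
Unset Strict Implicit.
Unset Printing Implicit Defensive.
Import Order.TTheory GRing.Theory Num.Theory.
Import numFieldNormedType.Exports.
Local Open Scope classical_set_scope.
Local Open Scope ring_scope.

(* The library's expectation, covariance and variance are extended reals; the
   real-valued versions below are meaningful for square-integrable variables. *)
Definition mean d (T : measurableType d) (R : realType) (P : probability T R)
  (X : T -> R) : R := fine 'E_P[X].

Definition cov d (T : measurableType d) (R : realType) (P : probability T R)
  (X Y : T -> R) : R := fine (covariance P X Y).

Definition var d (T : measurableType d) (R : realType) (P : probability T R)
  (X : T -> R) : R := fine 'V_P[X].

Definition sd d (T : measurableType d) (R : realType) (P : probability T R)
  (X : T -> R) : R := Num.sqrt (var P X).

Definition cor d (T : measurableType d) (R : realType) (P : probability T R)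
  (X Y : T -> R) : R := cov P X Y / (sd P X * sd P Y).

Definition mean_vec d (T : measurableType d) (R : realType)
  (P : probability T R) (n : nat) (U : T -> 'rV[R]_n) : 'rV[R]_n :=
  \row_i mean P (fun w => U w 0 i).

Definition gradient (R : realType) (n : nat) (F : 'rV[R]_n -> R)
  (x : 'rV[R]_n) : 'rV[R]_n := \row_i 'D_(delta_mx 0 i) F x.

(* Var (grad F(mu) . (U - mu)), for F differentiable at mu = E[U]. *)
Definition delta_var d (T : measurableType d) (R : realType)
  (P : probability T R) (n : nat) (U : T -> 'rV[R]_n) (F : 'rV[R]_n -> R) : R :=
  let mu := mean_vec P U in
  var P (fun w => \sum_(i < n) gradient F mu 0 i * (U w - mu) 0 i).

Definition row4 (R : realType) (a b c e : R) : 'rV[R]_4 :=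
  \row_(i < 4) [:: a; b; c; e]`_i.

(* The statistics, as functions of u = (y, h, ystar, hstar). *)
Section Statistics.
Context (R : realType) (g : R -> R) (theta : R).
Implicit Type u : 'rV[R]_4.

Definition gY u : R := g (u 0 0).
Definition gH u : R := g (u 0 1).
Definition gYs u : R := g (u 0 2).
Definition gHs u : R := g (u 0 3).

Definition stat0 u : R := gY u - gYs u.
Definition stat1 u : R := gY u - theta * gH u.
Definition stat2 u : R := gYs u - theta * gHs u.
Definition stat u : R := stat1 u - stat2 u.
End Statistics.

Definition minimizes (R : realType) (f : R -> R) (x : R) : Prop :=
  forall y, f x <= f y.

Definition unique_minimizer (R : realType) (f : R -> R) (x : R) : Prop :=
  minimizes f x /\ (forall y, minimizes f y -> y = x).

Definition is_minimum (R : realType) (f : R -> R) (m : R) : Prop :=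
  exists2 x, f x = m & minimizes f x.

(* Main.v *)
Require Import Defs.
From HB Require Import structures.
From mathcomp Require Import all_boot all_order all_algebra.
From mathcomp Require Import all_classical all_reals all_analysis.
From mathcomp Require Import ring.
Set Implicit Arguments.
Unset Strict Implicit.
Unset Printing Implicit Defensive.
Import Order.TTheory GRing.Theory Num.Theory.
Import numFieldNormedType.Exports.
Local Open Scope classical_set_scope.
Local Open Scope ring_scope.

(** Write primed letters for starred variables and dg for the derivative of g.
    Each statistic is a linear combination of g(Y), g(H), g(Y'), g(H'), so its
    delta-method variance is the quadratic form of the covariance matrix at
    (coefficients times dg); that matrix is block diagonal.  Hence V{T1}, V{T2}
    are parabolas A_i - 2 theta N_i + theta^2 D_i and V{T} is their sum.  The
    minimizers are N1/D1, N2/D2 and their mediant (N1 + N2)/(D1 + D2), whence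
    (c).  Under the hypotheses of (d), N1 = N2 = h r and D1 = D2 = h^2, so
    delta = 2 r^2 with r^2 = rho^2 A1 = rho'^2 A2. *)

(** * Gradient of a linear combination of coordinatewise transforms *)

Section Gradient.
Context (R : realType) (n : nat).

(** Along the i-th basis direction the difference quotient is literally that of [g] at [x 0 i] when
    i = j, and the zero function otherwise; no chain rule is involved. *)
Lemma is_derive_coord (g : R -> R) (x : 'rV[R]_n) (i j : 'I_n) :
  derivable g (x 0 j) 1 ->
  is_derive x (delta_mx 0 i) (fun u : 'rV[R]_n => g (u 0 j))
    ((i == j)%:R * derive1 g (x 0 j)).
Proof.
have [<-|neq_ij] := eqVneq i j => dg.
  have E : (fun h : R => h^-1 *: (((fun u : 'rV[R]_n => g (u 0 i)) \o shift x)
              (h *: delta_mx 0 i) - g (x 0 i))) =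
           (fun h : R =>
              h^-1 *: ((g \o shift (x 0 i)) (h *: (1 : R)) - g (x 0 i))).
    by apply/funext => h /=; rewrite !mxE !eqxx.
  by split; rewrite ?mul1r ?derive1E /derivable /derive E.
have E : (fun h : R => h^-1 *: (((fun u : 'rV[R]_n => g (u 0 j)) \o shift x)
            (h *: delta_mx 0 i) - g (x 0 j))) = cst 0.
  apply/funext => h /=.
  by rewrite !mxE eq_sym (negbTE neq_ij) andbF mulr0 add0r subrr scaler0.
split; rewrite /derivable /derive E; first exact: is_cvg_cst.
by rewrite mul0r; exact: lim_cst.
Qed.

Lemma gradient_comb (g : R -> R) (c x : 'rV[R]_n) :
  (forall j, derivable g (x 0 j) 1) ->
  gradient (fun u : 'rV[R]_n => \sum_j c 0 j * g (u 0 j)) x =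
  \row_i (c 0 i * derive1 g (x 0 i)).
Proof.
move=> dg; apply/rowP => i; rewrite !mxE.
have -> : (fun u : 'rV[R]_n => \sum_j c 0 j * g (u 0 j)) =
    \sum_j (c 0 j \*: (fun u : 'rV[R]_n => g (u 0 j))).
  by apply/funext => u; rewrite fct_sumE.
have := is_derive_sum (fun j => is_deriveZ (c 0 j) (is_derive_coord i (dg j))).
move=> [_ ->]; rewrite (bigD1 i)//= eqxx mul1r big1 ?addr0// => j.
by rewrite eq_sym => /negbTE ->; rewrite mul0r scaler0.
Qed.

End Gradient.

(** * Real-valued covariance on L2, and the delta-method variance as a quadratic form *)

Section Covariance.
Context (R : realType) d (T : measurableType d) (P : probability T R).
Implicit Types X Y Z : T -> R.

Lemma Lfun21 X : X \in Lfun P 2%:E -> X \in Lfun P 1.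
Proof. by apply: Lfun_subset12; exact: fin_num_measure. Qed.

Lemma Lfun2_scale a X :
  X \in Lfun P 2%:E -> (fun w => a * X w) \in Lfun P 2%:E.
Proof.
move=> X2; have -> : (fun w => a * X w) = a \o* X.
  by apply/funext => w /=; rewrite mulrC.
by apply: Lfun_scale => //; rewrite ler1n.
Qed.

Lemma Lfun2_sum n (X : 'I_n -> T -> R) :
  (forall i, X i \in Lfun P 2%:E) ->
  (fun w => \sum_i X i w) \in Lfun P 2%:E.
Proof.
move=> X2; have -> : (fun w => \sum_i X i w) = \sum_i X i.
  by apply/funext => w; rewrite fct_sumE.
by apply: rpred_sum => //; rewrite lee1n.
Qed.

Lemma fin_num_cov X Y : X \in Lfun P 2%:E -> Y \in Lfun P 2%:E ->
  covariance P X Y \is a fin_num.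
Proof.
move=> X2 Y2; apply: covariance_fin_num; [exact: Lfun21..|].
exact: Lfun2_mul_Lfun1.
Qed.

Lemma covC X Y : cov P X Y = cov P Y X.
Proof. by rewrite /cov covarianceC. Qed.

Lemma covDl X Y Z :
  X \in Lfun P 2%:E -> Y \in Lfun P 2%:E -> Z \in Lfun P 2%:E ->
  cov P (X \+ Y) Z = cov P X Z + cov P Y Z.
Proof. by move=> *; rewrite /cov covarianceDl// fineD// fin_num_cov. Qed.

Lemma covZl a X Y : X \in Lfun P 2%:E -> Y \in Lfun P 2%:E ->
  cov P (fun w => a * X w) Y = a * cov P X Y.
Proof.
move=> X2 Y2; have -> : (fun w => a * X w) = a \o* X.
  by apply/funext => w /=; rewrite mulrC.
rewrite /cov covarianceZl; [|exact: Lfun21..|exact: Lfun2_mul_Lfun1].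
by rewrite fineM// fin_num_cov.
Qed.

Lemma cov_suml n (c : 'I_n -> R) (X : 'I_n -> T -> R) Z :
  (forall i, X i \in Lfun P 2%:E) -> Z \in Lfun P 2%:E ->
  cov P (fun w => \sum_i c i * X i w) Z = \sum_i c i * cov P (X i) Z.
Proof.
elim: n c X => [|n IHn] c X X2 Z2.
  rewrite big_ord0; under eq_fun do rewrite big_ord0.
  by rewrite /cov -[fun _ => 0]/(cst 0) covariance_cst_l.
under eq_fun do rewrite big_ord_recl.
rewrite big_ord_recl -IHn// -covZl// -covDl ?Lfun2_scale//.
by apply: Lfun2_sum => i; exact: Lfun2_scale.
Qed.

Lemma var_comb n (c : 'I_n -> R) (X : 'I_n -> T -> R) :
  (forall i, X i \in Lfun P 2%:E) ->
  var P (fun w => \sum_i c i * X i w) =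
  \sum_i \sum_j c i * c j * cov P (X i) (X j).
Proof.
move=> X2; have S2 : (fun w => \sum_i c i * X i w) \in Lfun P 2%:E.
  by apply: Lfun2_sum => i; exact: Lfun2_scale.
(* The variance is by definition the covariance of the sum with itself, so it expands by linearity
   in each argument in turn. *)
rewrite /var -[fine _]/(cov P _ _) cov_suml//; apply: eq_bigr => i _.
rewrite covC cov_suml// mulr_sumr; apply: eq_bigr => j _.
by rewrite mulrA covC.
Qed.

Lemma varB_cst X a : X \in Lfun P 2%:E -> var P (fun w => X w - a) = var P X.
Proof. by move=> X2; rewrite /var -[in RHS](varianceB_cst_r a X2). Qed.

Lemma sd_sqr X : sd P X ^+ 2 = var P X.
Proof. by rewrite sqr_sqrtr// fine_ge0// variance_ge0. Qed.

Lemma cov_cor X Y : 0 < sd P X -> 0 < sd P Y ->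
  cov P X Y = cor P X Y * (sd P X * sd P Y).
Proof. by move=> sX sY; rewrite divfK// mulf_neq0// gt_eqF. Qed.

(** Serves the case g = log, where the derivative is taken at the means. The mean equals the
    integral of |X|; were it zero, X would vanish almost surely. *)
Lemma mean_gt0 X : X \in Lfun P 1 -> {ae P, forall w, 0 < X w} -> 0 < mean P X.
Proof.
move=> X1 X_gt0; have iX := X1; move/Lfun1_integrable: iX => iX.
have mX := measurable_int P iX.
have E : (\int[P]_w (X w)%:E = \int[P]_w `|(X w)%:E|)%E.
  apply: ae_eq_integral => //; first exact: measurable_int (integrable_abse iX).
  by apply: filterS X_gt0 => w X0 _; rewrite gee0_abs// lee_fin ltW.
rewrite /mean unlock lt_def fine_ge0 ?andbT; last first.
  by rewrite E integral_ge0.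
apply/negP; rewrite fine_eq0 ?integrable_fin_num// E => /eqP.
move/(ae_eq_integral_abs _ measurableT mX) => X_eq0.
suff: P setT = 0%E by rewrite probability_setT => -[/eqP]; rewrite oner_eq0.
(* X > 0 and X = 0 both hold almost surely, so the whole space lies in a null set, against P(T) =
   1. *)
have: {ae P, forall w, False}.
  move: X_gt0 X_eq0; apply: filterS2 => w X0 /(_ I) [X0'].
  by rewrite X0' ltxx in X0.
move=> [A [mA PA0 AT]]; apply: (subset_measure0 measurableT mA _ PA0).
by move=> w _; apply: AT.
Qed.

Lemma delta_var_comb n (U : T -> 'rV[R]_n) (g : R -> R) (c : 'rV[R]_n) :
  (forall i, (fun w => U w 0 i) \in Lfun P 2%:E) ->
  (forall i, derivable g (mean P (fun w => U w 0 i)) 1) ->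
  let b i := c 0 i * derive1 g (mean P (fun w => U w 0 i)) in
  delta_var P U (fun u => \sum_j c 0 j * g (u 0 j)) =
  \sum_i \sum_j b i * b j * cov P (fun w => U w 0 i) (fun w => U w 0 j).
Proof.
move=> U2 dg b; rewrite /delta_var gradient_comb; last first.
  by move=> i; rewrite mxE; exact: dg.
rewrite -(var_comb b U2).
(* The Taylor term is centred at the mean; this only subtracts a constant, which the variance
   ignores. *)
rewrite -[RHS](@varB_cst _ (\sum_i b i * mean P (fun w => U w 0 i))); last first.
  by apply: Lfun2_sum => i; exact: Lfun2_scale.
congr (var P _); apply/funext => w; rewrite -sumrB; apply: eq_bigr => i _.
by rewrite !mxE mulrBr.
Qed.

End Covariance.

(** One computation for all the statistics, which differ only in the coefficients a, b, c, e. The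
    vanishing cross-covariances leave two blocks, one for (Y, H) and one for (Y', H'). *)
Lemma delta_var_row4 (R : realType) d (T : measurableType d)
  (P : probability T R) (Y H Ys Hs : T -> R) (g : R -> R) (a b c e : R)
  (F : 'rV[R]_4 -> R) :
  Y \in Lfun P 2%:E -> H \in Lfun P 2%:E ->
  Ys \in Lfun P 2%:E -> Hs \in Lfun P 2%:E ->
  cov P Y Ys = 0 -> cov P Y Hs = 0 -> cov P H Ys = 0 -> cov P H Hs = 0 ->
  derivable g (mean P Y) 1 -> derivable g (mean P H) 1 ->
  derivable g (mean P Ys) 1 -> derivable g (mean P Hs) 1 ->
  (forall u, F u = a * gY g u + b * gH g u + c * gYs g u + e * gHs g u) ->
  let y : R := derive1 g (mean P Y) in let h : R := derive1 g (mean P H) in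
  let ys : R := derive1 g (mean P Ys) in let hs : R := derive1 g (mean P Hs) in
  delta_var P (fun w => row4 (Y w) (H w) (Ys w) (Hs w)) F =
    (a * y) ^+ 2 * sd P Y ^+ 2 + (b * h) ^+ 2 * sd P H ^+ 2
    + 2 * (a * b) * (h * y * cov P Y H)
    + ((c * ys) ^+ 2 * sd P Ys ^+ 2 + (e * hs) ^+ 2 * sd P Hs ^+ 2
    + 2 * (c * e) * (hs * ys * cov P Ys Hs)).
Proof.
move=> Y2 H2 Ys2 Hs2 cYYs cYHs cHYs cHHs dY dH dYs dHs FE y h ys hs.
pose X (i : 'I_4) : T -> R := [:: Y; H; Ys; Hs]`_i.
have UE i : (fun w => row4 (Y w) (H w) (Ys w) (Hs w) 0 i) = X i.
  by apply/funext => w; rewrite mxE /X; case: i => [[|[|[|[|]]]]].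
have XP (Q : (T -> R) -> Prop) : Q Y -> Q H -> Q Ys -> Q Hs -> forall i, Q (X i).
  by move=> ? ? ? ? [[|[|[|[|]]]]].
have -> : F = fun u => \sum_j row4 a b c e 0 j * g (u 0 j).
  apply/funext => u; rewrite FE !big_ord_recl big_ord0 !mxE /= addr0 !addrA.
  (* The iterated lifts from [big_ord_recl] and the literals 1, 2, 3 are identified through their
     values. *)
  congr (_ + _ * g (u 0 _) + _ * g (u 0 _) + _ * g (u 0 _)); exact/val_inj.
rewrite delta_var_comb; last 2 first.
- by move=> i; rewrite UE; exact: (XP (fun Z => Z \in Lfun P 2%:E)).
- move=> i; rewrite UE.
  exact: (XP (fun Z => derivable g (mean P Z) 1) dY dH dYs dHs).
under eq_bigr do under eq_bigr do rewrite !UE.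
rewrite !big_ord_recl !big_ord0 /X !mxE /=.
rewrite (covC P H Y) (covC P Hs Ys) (covC P Ys Y) (covC P Ys H).
rewrite (covC P Hs Y) (covC P Hs H) cYYs cYHs cHYs cHHs.
rewrite -/y -/h -/ys -/hs !sd_sqr.
rewrite -[var P Y]/(cov P Y Y) -[var P H]/(cov P H H).
rewrite -[var P Ys]/(cov P Ys Ys) -[var P Hs]/(cov P Hs Hs).
ring.
Qed.

(** * Parabolas, mediants and the derivative of the logarithm *)

Lemma quadratic_minimizer (R : realType) (f : R -> R) (K N D : R) :
  0 < D -> (forall x, f x = K - 2 * x * N + x ^+ 2 * D) ->
  unique_minimizer f (N / D) /\ f (N / D) = K - N ^+ 2 / D.
Proof.
move=> D0 fE; have Dn : D != 0 by rewrite gt_eqF.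
have fV : f (N / D) = K - N ^+ 2 / D by rewrite fE; field.
(* Completing the square gives both minimality and uniqueness. *)
have sq x : f x = f (N / D) + D * (x - N / D) ^+ 2 by rewrite fV fE; field.
split=> //; split=> [x|x /(_ (N / D))].
  by rewrite (sq x) lerDl mulr_ge0 ?sqr_ge0// ltW.
rewrite (sq x) gerDl pmulr_rle0// => xle.
have : (x - N / D) ^+ 2 == 0 by rewrite eq_le xle sqr_ge0.
by rewrite sqrf_eq0 subr_eq0 => /eqP.
Qed.

(** The mediant is the average of the two ratios with positive weights D1 and D2. *)
Lemma mediant_between (R : realFieldType) (N1 N2 D1 D2 : R) :
  0 < D1 -> 0 < D2 ->
  Num.min (N1 / D1) (N2 / D2) <= (N1 + N2) / (D1 + D2)
    <= Num.max (N1 / D1) (N2 / D2).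
Proof.
move=> D10 D20; set x := N1 / D1; set y := N2 / D2.
have -> : N1 = x * D1 by rewrite divfK// gt_eqF.
have -> : N2 = y * D2 by rewrite divfK// gt_eqF.
rewrite ler_pdivlMr ?addr_gt0// ler_pdivrMr ?addr_gt0// !mulrDr.
by rewrite !lerD// ler_pM2r// ?ge_min ?le_max lexx ?orbT.
Qed.

(** [g] agrees with [ln] on a neighbourhood of x > 0, and the derivative is local. *)
Lemma derive1_eq_ln (R : realType) (g : R -> R) (x : R) :
  (forall z, 0 < z -> g z = ln z) -> 0 < x -> derive1 g x = x^-1.
Proof.
move=> gE x0; rewrite derive1E.
have [_ <-] := is_derive1_ln x0; apply: near_eq_derive.
by near=> z; apply: gE; near: z; exact: lt_nbhsr.
Unshelve. all: by end_near. Qed.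

(** * Optimal coefficient, variance reduction and bounds *)

Theorem theorem3p2 (R : realType) (d : measure_display) (T : measurableType d)
  (P : probability T R) (Y H Ys Hs : {RV P >-> R}) (g : R -> R)
  (Y_L2 : (Y : T -> R) \in Lfun P 2%:E) (H_L2 : (H : T -> R) \in Lfun P 2%:E)
  (Ys_L2 : (Ys : T -> R) \in Lfun P 2%:E)
  (Hs_L2 : (Hs : T -> R) \in Lfun P 2%:E)
  (sdY_gt0 : 0 < sd P Y) (sdH_gt0 : 0 < sd P H)
  (sdYs_gt0 : 0 < sd P Ys) (sdHs_gt0 : 0 < sd P Hs)
  (cor_Y_Ys : cor P Y Ys = 0) (cor_Y_Hs : cor P Y Hs = 0)
  (cor_H_Ys : cor P H Ys = 0) (cor_H_Hs : cor P H Hs = 0)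
  (g_dY : derivable g (mean P Y) 1) (g_dH : derivable g (mean P H) 1)
  (g_dYs : derivable g (mean P Ys) 1) (g_dHs : derivable g (mean P Hs) 1)
  (g'H_neq0 : derive1 g (mean P H) != 0) (g'Hs_neq0 : derive1 g (mean P Hs) != 0) :
  let V := delta_var P (fun w => row4 (Y w) (H w) (Ys w) (Hs w)) in
  let VT := fun theta => V (stat g theta) in
  let muY := mean P Y in let muH := mean P H in
  let muYs := mean P Ys in let muHs := mean P Hs in
  let g'Y : R := derive1 g muY in let g'H : R := derive1 g muH in
  let g'Ys : R := derive1 g muYs in let g'Hs : R := derive1 g muHs in
  let rho := cor P Y H in let rhos := cor P Ys Hs in
  let theta_opt :=
    (g'H * g'Y * cov P Y H + g'Hs * g'Ys * cov P Ys Hs)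
      / (g'H ^+ 2 * sd P H ^+ 2 + g'Hs ^+ 2 * sd P Hs ^+ 2) in
  let delta :=
    (g'H * g'Y * cov P Y H + g'Hs * g'Ys * cov P Ys Hs) ^+ 2
      / (g'H ^+ 2 * sd P H ^+ 2 + g'Hs ^+ 2 * sd P Hs ^+ 2) in
  let g_is_id := forall x, g x = x in
  let g_is_log := (forall x, 0 < x -> g x = ln x) /\
    {ae P, forall w, [/\ 0 < Y w, 0 < H w, 0 < Ys w & 0 < Hs w]} in
  [/\ (* (a) *)
      [/\ unique_minimizer VT theta_opt,
          g_is_id -> theta_opt =
            (cov P Y H + cov P Ys Hs) / (sd P H ^+ 2 + sd P Hs ^+ 2)
        & g_is_log -> theta_opt =
            (cov P Y H / (muH * muY) + cov P Ys Hs / (muHs * muYs))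
              / (sd P H ^+ 2 / muH ^+ 2 + sd P Hs ^+ 2 / muHs ^+ 2)],
      (* (b) *)
      [/\ is_minimum VT
            (g'Y ^+ 2 * sd P Y ^+ 2 + g'Ys ^+ 2 * sd P Ys ^+ 2 - delta),
          V (stat0 g) - VT theta_opt = delta,
          g_is_id -> delta =
            (cov P Y H + cov P Ys Hs) ^+ 2 / (sd P H ^+ 2 + sd P Hs ^+ 2)
        & g_is_log -> delta =
            (cov P Y H / (muH * muY) + cov P Ys Hs / (muHs * muYs)) ^+ 2
              / (sd P H ^+ 2 / muH ^+ 2 + sd P Hs ^+ 2 / muHs ^+ 2)],
      (* (c) *)
      (exists theta1 theta2 : R,
        [/\ unique_minimizer (fun theta => V (stat1 g theta)) theta1,
            unique_minimizer (fun theta => V (stat2 g theta)) theta2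
          & Num.min theta1 theta2 <= theta_opt <= Num.max theta1 theta2])
    & (* (d) *)
      (g'H * sd P H = g'Hs * sd P Hs ->
       rho * (g'Y * sd P Y) = rhos * (g'Ys * sd P Ys) ->
       VT theta_opt =
         (1 - rho ^+ 2) * V (gY g) + (1 - rhos ^+ 2) * V (gYs g) /\
       (1 - rho ^+ 2) * V (gY g) + (1 - rhos ^+ 2) * V (gYs g) <=
         (1 - Num.min (rho ^+ 2) (rhos ^+ 2)) * V (stat0 g))].
Proof.
move=> V VT muY muH muYs muHs g'Y g'H g'Ys g'Hs rho rhos theta_opt delta.
move=> g_is_id g_is_log.
have cov0 X Z : 0 < sd P X -> 0 < sd P Z -> cor P X Z = 0 -> cov P X Z = 0.
  by move=> sX sZ cXZ; rewrite cov_cor// cXZ mul0r.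
have VE a b c e (F : 'rV[R]_4 -> R) := @delta_var_row4 R d T P Y H Ys Hs g
  a b c e F Y_L2 H_L2 Ys_L2 Hs_L2
  (cov0 _ _ sdY_gt0 sdYs_gt0 cor_Y_Ys) (cov0 _ _ sdY_gt0 sdHs_gt0 cor_Y_Hs)
  (cov0 _ _ sdH_gt0 sdYs_gt0 cor_H_Ys) (cov0 _ _ sdH_gt0 sdHs_gt0 cor_H_Hs)
  g_dY g_dH g_dYs g_dHs.
rewrite /= -/V -/muY -/muH -/muYs -/muHs -/g'Y -/g'H -/g'Ys -/g'Hs in VE.
set N1 := g'H * g'Y * cov P Y H in VE theta_opt delta *.
set N2 := g'Hs * g'Ys * cov P Ys Hs in VE theta_opt delta *.
pose A1 := g'Y ^+ 2 * sd P Y ^+ 2; pose A2 := g'Ys ^+ 2 * sd P Ys ^+ 2.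
pose D1 := g'H ^+ 2 * sd P H ^+ 2; pose D2 := g'Hs ^+ 2 * sd P Hs ^+ 2.
(* In each formula below, [VE] receives the coefficients of the statistic on g(Y), g(H), g(Y'),
   g(H'). *)
have V0 : V (stat0 g) = A1 + A2.
  rewrite (VE 1 0 (-1) 0) => [|u]; first by rewrite /A1 /A2; ring.
  by rewrite /stat0; ring.
have VY : V (gY g) = A1.
  by rewrite (VE 1 0 0 0) => [|u]; rewrite /A1; ring.
have VYs : V (gYs g) = A2.
  by rewrite (VE 0 0 1 0) => [|u]; rewrite /A2; ring.
have V1 x : V (stat1 g x) = A1 - 2 * x * N1 + x ^+ 2 * D1.
  rewrite (VE 1 (- x) 0 0) => [|u]; first by rewrite /A1 /D1 /N1; ring.
  by rewrite /stat1; ring.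
have V2 x : V (stat2 g x) = A2 - 2 * x * N2 + x ^+ 2 * D2.
  rewrite (VE 0 0 1 (- x)) => [|u]; first by rewrite /A2 /D2 /N2; ring.
  by rewrite /stat2; ring.
(* The sign of T2 in T = T1 - T2 disappears in the quadratic form, so the two parabolas add. *)
have VTE x : VT x = A1 + A2 - 2 * x * (N1 + N2) + x ^+ 2 * (D1 + D2).
  rewrite /VT (VE 1 (- x) (-1) x) => [|u].
    by rewrite /A1 /A2 /D1 /D2 /N1 /N2; ring.
  by rewrite /stat /stat1 /stat2; ring.
have D1_gt0 : 0 < D1 by rewrite mulr_gt0 // exprn_even_gt0//= gt_eqF.
have D2_gt0 : 0 < D2 by rewrite mulr_gt0 // exprn_even_gt0//= gt_eqF.
have [min_opt val_opt] := quadratic_minimizer (addr_gt0 D1_gt0 D2_gt0) VTE.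
rewrite -/theta_opt in min_opt val_opt.
rewrite -/delta in val_opt.
have id1 x : g_is_id -> derive1 g x = 1.
  move=> gE; have -> : g = id by apply/funext => z; rewrite gE.
  by rewrite derive1_id.
have idE : g_is_id -> [/\ g'Y = 1, g'H = 1, g'Ys = 1 & g'Hs = 1].
  by move=> gE; split; exact: id1.
have logE : g_is_log ->
    [/\ g'Y = muY^-1, g'H = muH^-1, g'Ys = muYs^-1 & g'Hs = muHs^-1].
  move=> [gE pos].
  have log1 X : X \in Lfun P 2%:E -> {ae P, forall w, 0 < X w} ->
      derive1 g (mean P X) = (mean P X)^-1.
    by move=> X2 X0; apply: derive1_eq_ln => //; apply: mean_gt0 => //;
      exact: Lfun21.
  by split; apply: log1 => //; apply: filterS pos => w [].
split.
- split=> // [/idE|/logE] [yE hE ysE hsE].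
  + by rewrite /theta_opt /N1 /N2 yE hE ysE hsE !expr1n !mul1r.
  + rewrite /theta_opt /N1 /N2 yE hE ysE hsE !exprVn -!invfM.
    by congr (_ / _); rewrite mulrC [X in _ + X]mulrC.
- split.
  + by exists theta_opt => //; case: min_opt.
  + by rewrite V0 val_opt; ring.
  + move=> /idE [yE hE ysE hsE].
    by rewrite /delta /N1 /N2 yE hE ysE hsE !expr1n !mul1r.
  + move=> /logE [yE hE ysE hsE].
    rewrite /delta /N1 /N2 yE hE ysE hsE !exprVn -!invfM.
    by congr (_ ^+ 2 / _); rewrite mulrC [X in _ + X]mulrC.
- exists (N1 / D1), (N2 / D2); split.
  + by have [] := quadratic_minimizer D1_gt0 V1.
  + by have [] := quadratic_minimizer D2_gt0 V2.
  + exact: mediant_between.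
- move=> eqH eqY.
  have covYH : cov P Y H = rho * (sd P Y * sd P H) by exact: cov_cor.
  have covYHs : cov P Ys Hs = rhos * (sd P Ys * sd P Hs) by exact: cov_cor.
  (* [h] and [r] are the two quantities that the hypotheses of (d) equate with their starred
     counterparts. *)
  pose h := g'H * sd P H.
  have h0 : h != 0 by rewrite mulf_neq0// gt_eqF.
  pose r := rho * (g'Y * sd P Y).
  have N1E : N1 = h * r by rewrite /N1 covYH /h /r; ring.
  have N2E : N2 = h * r.
    by rewrite /N2 covYHs /h /r eqH eqY; ring.
  have D1E : D1 = h ^+ 2 by rewrite /h exprMn.
  have D2E : D2 = h ^+ 2 by rewrite /h eqH exprMn.
  have deltaE : delta = 2 * r ^+ 2.
    by rewrite /delta -/D1 -/D2 N1E N2E D1E D2E; field;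
      rewrite -D1E gt_eqF// addr_gt0.
  have r1 : r ^+ 2 = rho ^+ 2 * A1 by rewrite /r /A1; ring.
  have r2 : r ^+ 2 = rhos ^+ 2 * A2 by rewrite /r eqY /A2; ring.
  rewrite val_opt V0 VY VYs; split.
    (* delta = r^2 + r^2: one copy is charged to A1 through rho, the other to A2 through rho'. *)
    by rewrite deltaE mulr2n mulrDl mul1r {1}r1 r2; ring.
  (* V{T0} = A1 + A2 with both terms nonnegative, so each factor 1 - rho^2, 1 - rho'^2 is bounded
     separately. *)
  rewrite mulrDr; apply: lerD; apply: ler_wpM2r.
  - by rewrite mulr_ge0 ?sqr_ge0.
  - by rewrite lerD2l lerN2 ge_min lexx.
  - by rewrite mulr_ge0 ?sqr_ge0.
  - by rewrite lerD2l lerN2 ge_min lexx orbT.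
Qed.
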